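(* Let $\Sigma$ be a finite alphabet with at least two letters, let $n\ge 2$ be an even integer and $n/2\le k\le n-1$. Let $(L_i,R_i)_{i\in\{1,\dots,k\}}$ be an admissible family, let $C=C\big((L_i,R_i)_i\big)\subseteq\Sigma^n$ be its associated code, and suppose that $C$ is a maximal $(1,k)$-overlap-free code and that $L_{n/2}\cup R_{n/2}=\{u\}$ for a single word $u$. Then the following statements hold. (i) For all $t\in\{1,\dots,k\}$ distinct from $n/2$, every $x\in L_t$ is a prefix in $C$ and every $x\in R_t$ is a suffix in $C$. (ii) If $u\in L_{n/2}$ and $u$ is not a prefix in $C$, then for every non-empty $L_j$ with $2\le j\le k-n/2$, the (unique) word in $L_jL_{n/2}$ is a prefix in $C$. Moreover, if $k>n/2$, then either the word in $L_1L_{n/2}$ is a prefix in $C$, or $L_{n/2-1}$ is empty and for every non-empty $L_j$ with $1\le j\le k-n/2-1$, the word in $L_jL_1L_{n/2}$ is a prefix in $C$. (iii) If $u\in R_{n/2}$ and $u$ is not a suffix in $C$, then for every non-empty $R_j$ with $2\le j\le k-n/2$, the (unique) word in $R_{n/2}R_j$ is a suffix in $C$. Moreover, if $k>n/2$, then either the word in $R_{n/2}R_1$ is a suffix in $C$, or $R_{n/2-1}$ is empty and for every non-empty $R_j$ with $1\le j\le k-n/2-1$, the word in $R_{n/2}R_1R_j$ is a suffix in $C$.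
   Context: For sets of words $L,R$, $LR$ denotes the set of all concatenations $lr$ with $l\in L$, $r\in R$. A composition of a positive integer $m$ is a tuple $\alpha=(\alpha_1,\dots,\alpha_p)$ of positive integers with sum $m$; $\mathrm{par}(\alpha)=p$ is its number of parts; the only composition of $0$ is the empty one, with $\mathrm{par}=0$. A word $x$ is a prefix (suffix) in $C$ if some codeword of $C$ begins (ends) with $x$. Two (not necessarily distinct) words $u,v$ have a $t$-overlap if the prefix of $u$ of length $t$ equals the suffix of $v$ of length $t$, or vice versa. A code $C\subseteq\Sigma^n$ is $(1,k)$-overlap-free if for all $1\le t\le k$ no two (not necessarily distinct) codewords have a $t$-overlap. A $(1,k)$-overlap-free code $C\subseteq\Sigma^n$ is maximal if for every $w\in\Sigma^n\setminus C$ the code $C\cup\{w\}$ is not $(1,k)$-overlap-free. A family $(L_i,R_i)_{i\in\{1,\dots,k\}}$ is admissible if $(L_1,R_1)$ is a partition of $\Sigma$ into two non-empty parts and, for every $i\in\{2,\dots,k\}$, $(L_i,R_i)$ is a partition of $\bigcup_{j=1}^{i-1}L_jR_{i-j}$ into two disjoint, possibly empty, parts. The associated code is $$C\big((L_i,R_i)_i\big)=\bigcup_{s=k+1}^{n}\ \bigcup_{j=s-k}^{k}\ \bigcup_{\alpha}\ \bigcup_{i=0}^{\mathrm{par}(\alpha)} L_{\alpha_1}\cdots L_{\alpha_i}\,L_jR_{s-j}\,R_{\alpha_{i+1}}\cdots R_{\alpha_{\mathrm{par}(\alpha)}}\subseteq\Sigma^n,$$ where $\alpha$ ranges over all compositions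 of $n-s$. When $|L_{n/2}\cup R_{n/2}|=1$, the alphabet is binary and $|L_i\cup R_i|=1$ for $1<i<n/2$ (and $|L_1|=|R_1|=1$), so the words referred to as ''the word in'' a product of non-empty sets in (ii) and (iii) are unique. *)

(* Defs.v *)
From mathcomp Require Import all_boot.
From mathcomp Require Import classical_sets.

Set Implicit Arguments.
Unset Strict Implicit.
Unset Printing Implicit Defensive.

Local Open Scope classical_set_scope.

(* A word over the alphabet T is a [seq T]; a set of words is a (Prop-valued)
   [set (seq T)], and Sigma^n is the set of words of size n. *)

Definition words (T : finType) (n : nat) : set (seq T) :=
  [set w | size w = n].

Definition lcat (T : finType) (A B : set (seq T)) : set (seq T) :=
  [set x ++ y | x in A & y in B].

Definition lcats (T : finType) (As : seq (set (seq T))) : set (seq T) :=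
  foldr (@lcat T) [set [::]] As.

Definition composition (m : nat) : set (seq nat) :=
  [set a | all (leq 1) a /\ sumn a = m].

Definition prefix_in (T : finType) (C : set (seq T)) (x : seq T) : Prop :=
  exists2 c, C c & prefix x c.

Definition suffix_in (T : finType) (C : set (seq T)) (x : seq T) : Prop :=
  exists2 c, C c & suffix x c.

(* Only meaningful for t <= size u and t <= size v. *)
Definition t_overlap (T : finType) (t : nat) (u v : seq T) : Prop :=
  take t u = drop (size v - t) v \/ take t v = drop (size u - t) u.

Definition overlap_free (T : finType) (k : nat) (C : set (seq T)) : Prop :=
  forall t, 1 <= t <= k -> forall u v, C u -> C v -> ~ t_overlap t u v.

Definition maximal_overlap_free (T : finType) (n k : nat)
    (C : set (seq T)) : Prop :=
  [/\ C `<=` words n,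
      overlap_free k C
    & forall w, words n w -> ~ C w -> ~ overlap_free k (C `|` [set w])].

Definition bipartition (T : finType) (A B S : set (seq T)) : Prop :=
  A `|` B = S /\ A `&` B = set0.

(* Families indexed by {1..k} are functions on nat whose values outside {1..k}
   are irrelevant; a letter is identified with the word of size 1. *)
Definition admissible (T : finType) (k : nat)
    (L R : nat -> set (seq T)) : Prop :=
  [/\ bipartition (L 1) (R 1) (words 1),
      L 1 !=set0,
      R 1 !=set0
    & forall i, 2 <= i <= k ->
        bipartition (L i) (R i)
          (\bigcup_(j in [set j | 1 <= j <= i - 1]) lcat (L j) (R (i - j)))].

Definition associated_code (T : finType) (n k : nat)
    (L R : nat -> set (seq T)) : set (seq T) :=
  \bigcup_(s in [set s | k + 1 <= s <= n])
  \bigcup_(j in [set j | s - k <= j <= k])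
  \bigcup_(a in composition (n - s))
  \bigcup_(i in [set i | 0 <= i <= size a])
    lcat (lcats (map L (take i a)))
      (lcat (lcat (L j) (R (s - j))) (lcats (map R (drop i a)))).

(* Main.v *)
Require Import Defs.
From mathcomp Require Import all_boot.
From mathcomp Require Import boolp classical_sets.
From mathcomp Require Import zify.

Local Open Scope classical_set_scope.

(* Call lw (rw) the union of the L_i (of the R_i), 1 <= i <= k. Proper suffixes
   of words of lw or rw lie in rw*, proper prefixes lie in lw*, and lw* and rw*
   meet only in the empty word; so short prefixes of codewords lie in lw* and
   short suffixes in rw*. A word w of length n in lw+ is therefore blocked, when
   added to C, only by a suffix of w in lw* that is a prefix of C or of w.
   (i) If x in L_t is not a prefix in C, then R_(n-t) is empty, so there is z in
   L_(n-t); then zx can be added to C, unless x is a prefix of z, in which case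
   xz can.
   (ii) If z v has the length of u, with z, v in lw, and neither u nor vu is a
   prefix in C, then zvu can be added to C. Since all the sets L_i or R_i with
   i <= n/2 have at most one word, such a z exists for 2 <= |v|. For |v| = 1 it
   may fail to exist, but then k = n - 1 and vu is a prefix in C directly; so the
   first alternative of the last claim of (ii) always holds.
   (iii) is (ii) for the reversed words. *)

Section LRSystems.
Set Implicit Arguments.
Unset Strict Implicit.

Variable T : finType.
Implicit Types (P lw rw : set (seq T)) (p q r s u v w x y z : seq T).

(** * Two factorizations of one word, and the monoid generated by a set of words *)

(** Levi's lemma; asking for a non-empty [c] in the second case only makes the two cases
    exclusive. *)
Lemma cat_eq_cat p s x y : p ++ s = x ++ y ->
  (exists c, p = x ++ c /\ y = c ++ s) \/
  (exists2 c, 0 < size c & x = p ++ c /\ s = c ++ y).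
Proof.
elim: p x => [|a p IHp] [|b x] /=.
- by move=> ->; left; exists [::].
- by move=> ->; right; exists (b :: x).
- by move=> <-; left; exists (a :: p).
move=> [-> /IHp [[c [-> ->]]|[c hc [-> ->]]]]; [left|right]; by exists c.
Qed.

Lemma cat_inj_size p s x y :
  size p = size x \/ size s = size y -> p ++ s = x ++ y -> p = x /\ s = y.
Proof.
move=> hs e; have es : size (p ++ s) = size (x ++ y) by rewrite e.
rewrite !size_cat in es.
have hp : size p = size x by lia.
by move/eqP: e; rewrite eqseq_cat // => /andP [/eqP -> /eqP ->].
Qed.

Inductive star P : seq T -> Prop :=
| star_nil : star P [::]
| star_cons x w : P x -> star P w -> star P (x ++ w).

Lemma star1 P x : P x -> star P x.
Proof.
by move=> Px; rewrite -[x]cats0; apply: star_cons => //; apply: star_nil.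
Qed.

Lemma star_cat P x y : star P x -> star P y -> star P (x ++ y).
Proof. by elim=> // a w Pa _ IH /IH; rewrite -catA; apply: star_cons. Qed.

Lemma comp_revK P : (P \o rev) \o rev = P.
Proof. by apply/funext => x /=; rewrite revK. Qed.

Lemma star_rev P x : star P x -> star (P \o rev) (rev x).
Proof.
elim=> [|a w Pa _ IH]; first exact: star_nil.
by rewrite rev_cat; apply: star_cat => //; apply: star1; rewrite /= revK.
Qed.

(** * Admissible families with their indices forgotten *)

Record lr_system k lw rw : Prop := LRSystem {
  lw_size : forall x, lw x -> 0 < size x <= k;
  rw_size : forall x, rw x -> 0 < size x <= k;
  lr_disjoint : forall x, lw x -> rw x -> False;
  lw_letter : exists2 a, lw a & size a = 1;
  rw_letter : exists2 b, rw b & size b = 1;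
  lr_factor : forall w, (lw `|` rw) w -> 1 < size w ->
    exists x y, [/\ lw x, rw y & w = x ++ y];
  lr_merge : forall x y, lw x -> rw y -> size x + size y <= k ->
    (lw `|` rw) (x ++ y) }.

(** Reversal exchanges [lw] and [rw]; the results on suffixes in the code are deduced from those on
    prefixes through it. *)
Lemma lr_system_rev k lw rw :
  lr_system k lw rw -> lr_system k (rw \o rev) (lw \o rev).
Proof.
move=> H; split=> /=.
- by move=> x /(rw_size H); rewrite size_rev.
- by move=> x /(lw_size H); rewrite size_rev.
- by move=> x hr hl; apply: (lr_disjoint H hl hr).
- by have [b hb sb] := rw_letter H; exists (rev b); rewrite /= ?revK ?size_rev.
- by have [b hb sb] := lw_letter H; exists (rev b); rewrite /= ?revK ?size_rev.
- move=> w hw sw.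
  have hw' : (lw `|` rw) (rev w) by case: hw; [right|left].
  have [|x [y [hx hy e]]] := lr_factor H hw'; first by rewrite size_rev.
  exists (rev y), (rev x); rewrite !revK; split=> //.
  by rewrite -rev_cat -e revK.
- move=> x y hx hy sxy; rewrite rev_cat.
  have := lr_merge H hy hx; rewrite !size_rev addnC => /(_ sxy).
  by case; [right|left].
Qed.

(** * Overlaps between words of a system *)

Section System.
Variables (k : nat) (lw rw : set (seq T)).
Hypothesis H : lr_system k lw rw.
Let S : set (seq T) := lw `|` rw.

Lemma lr_size x : S x -> 0 < size x <= k.
Proof. by case; [apply: (lw_size H)|apply: (rw_size H)]. Qed.

(** Induction on the length. The cut falls in one of the two factors [x], [y]: in [y] it leaves [y]
    or a proper suffix of [y], in [x] a proper suffix of [x] followed by [y]. *)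
Lemma proper_suffix p s : S (p ++ s) -> 0 < size p -> star rw s.
Proof.
have [m] := ubnP (size (p ++ s)); elim: m p s => // m IH p s hm hS hp.
have [s1|s2] := leqP (size (p ++ s)) 1.
  have -> : s = [::] by case: s s1 {hm hS} => // ? ?; rewrite size_cat /=; lia.
  exact: star_nil.
have [x [y [hx hy e]]] := lr_factor H hS s2.
have [sx sy] := (lw_size H hx, rw_size H hy).
have es : size (p ++ s) = size x + size y by rewrite e size_cat.
case: (cat_eq_cat e) => [[[|c0 c] [ep ey]]|[c hc [ex ->]]].
- by rewrite -[s]/([::] ++ s) -ey; apply: star1.
- apply: (IH (c0 :: c)) => //; rewrite -ey; [lia|by right].
apply: star_cat; last exact: star1.
apply: (IH p) => //; rewrite -ex; [lia|by left].
Qed.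

Lemma proper_prefix p s : S (p ++ s) -> 0 < size s -> star lw p.
Proof.
have [m] := ubnP (size (p ++ s)); elim: m p s => // m IH p s hm hS hp.
have [s1|s2] := leqP (size (p ++ s)) 1.
  have -> : p = [::] by case: p s1 {hm hS} => // ? ?; rewrite size_cat /=; lia.
  exact: star_nil.
have [x [y [hx hy e]]] := lr_factor H hS s2.
have [sx sy] := (lw_size H hx, rw_size H hy).
have es : size (p ++ s) = size x + size y by rewrite e size_cat.
case: (cat_eq_cat e) => [[c [-> ey]]|[c hc [ex es']]].
- apply: star_cat; first exact: star1.
  apply: (IH c s) => //; rewrite -ey; [lia|by right].
by apply: (IH p c) => //; rewrite -ex; [lia|left].
Qed.

Lemma star_rw_suffix p s : star rw (p ++ s) -> star rw s.
Proof.
move e: (p ++ s) => w hw; elim: hw p s e => [|x w' hx hw IH] p s e.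
  by case: p s e => [|? ?] [|? ?] //= _; apply: star_nil.
case: (cat_eq_cat e) => [[c [_ /esym /IH //]]|[c hc [ex ->]]].
apply: star_cat => //; case: p ex {e} => [|p0 p] ex.
  by rewrite -[c]/([::] ++ c) -ex; apply: star1.
by apply: (@proper_suffix (p0 :: p)) => //; rewrite -ex; right.
Qed.

Lemma star_lw_prefix p s : star lw (p ++ s) -> star lw p.
Proof.
move e: (p ++ s) => w hw; elim: hw p s e => [|x w' hx hw IH] p s e.
  by case: p s e => [|? ?] [|? ?] //= _; apply: star_nil.
case: (cat_eq_cat e) => [[c [-> /esym /IH hc]]|[c hc [ex _]]].
  exact: star_cons.
by apply: (@proper_prefix p c) => //; rewrite -ex; left.
Qed.

(* In a shortest counterexample, the first factor [x] from [rw] is a prefix of a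
   word of [star lw], hence is the whole word; then so is the first factor [a]
   of it from [lw], since the rest is a proper suffix of [x]. *)
Lemma star_disjoint w : star lw w -> star rw w -> w = [::].
Proof.
have [m] := ubnP (size w); elim: m w => // m IH w hm hl hr.
case: hr hm hl => // x y hx hy hm hl.
have sx := rw_size H hx.
have hxl : star lw x by apply: star_lw_prefix hl.
have y0 : y = [::].
  have [ey|ey] := leqP (size y) 0; first by case: y ey {hm hl hy}.
  have x0 : x = [::].
    by apply: IH => //; [rewrite size_cat in hm; lia|exact: star1].
  by rewrite x0 in sx.
rewrite {}y0 cats0 in hm hl *; case: hxl hx sx hm {hl hy y} => // a w' ha hw' hx sx hm.
have sa := lw_size H ha.
have w0 : w' = [::].
  apply: IH; [rewrite size_cat in hm; lia| |] => //.
  by apply: (@proper_suffix a w'); [right|lia].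
by rewrite w0 cats0 in hx; case: (lr_disjoint H ha hx).
Qed.

(** The shared factor [c] is a proper suffix of one word and a proper prefix of the other, so it
    lies in both monoids. *)
Lemma no_overlap p c s : S (p ++ c) -> S (c ++ s) ->
  0 < size p -> 0 < size c -> 0 < size s -> False.
Proof.
move=> h1 h2 sp sc ss.
by rewrite (star_disjoint (proper_prefix h2 ss) (proper_suffix h1 sp)) in sc.
Qed.

(** A word of [lw] is lengthened by a letter of [rw] on the right, a word of [rw] by a letter of
    [lw] on the left. *)
Lemma lr_exists i : 0 < i <= k -> exists2 x, S x & size x = i.
Proof.
elim: i => // i IH hi; have [a ha sa] := lw_letter H.
have [b hb sb] := rw_letter H.
case: i IH hi => [|i] IH hi; first by exists a => //; left.
have [|x [hx|hx] sx] := IH; first lia.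
  exists (x ++ b); last by rewrite size_cat; lia.
  by apply: (lr_merge H) => //; lia.
exists (a ++ x); last by rewrite size_cat; lia.
by apply: (lr_merge H) => //; lia.
Qed.

(** * Consequences of having a single word of length [h] *)

Section Unique.
Variables (h : nat) (u : seq T).
Hypothesis hhk : h <= k.
Hypothesis hu : forall x, S x -> size x = h -> x = u.

(** Descending induction on the length, from [h]: both words are lengthened by one letter, and the
    longer words coincide. Letters of different kinds have to be set apart, hence the last
    hypothesis. *)
Lemma lr_unique x y : S x -> S y -> size x = size y -> size x <= h ->
  [\/ 1 < size x, lw x /\ lw y | rw x /\ rw y] -> x = y.
Proof.
have [m] := ubnP (h - size x); elim: m x y => // m IH x y hm hx hy sxy sh kind.
have [eh|nh] := eqVneq (size x) h; first by rewrite (hu hx eh) (hu hy (etrans (esym sxy) eh)).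
have [a ha sa] := lw_letter H; have [b hb sb] := rw_letter H.
have hxb z : size z = size x -> lw z -> S (z ++ b).
  by move=> sz hz; apply: (lr_merge H) => //; lia.
have hax z : size z = size x -> rw z -> S (a ++ z).
  by move=> sz hz; apply: (lr_merge H) => //; lia.
have sx0 := lr_size hx.
have eqS z t : S z -> S t -> size z = (size x).+1 -> size t = (size x).+1 ->
  z = t.
  by move=> hz ht sz st; apply: IH => //; try lia; constructor; lia.
(* This case is contradictory: [z ++ b = a ++ t] makes [z] and [t] overlap in a non-empty word, as
   they are longer than one letter. *)
have mixed z t : 1 < size x -> size z = size x -> size t = size x ->
    lw z -> rw t -> z = t.
  move=> s1 sz st hz ht.
  have e : z ++ b = a ++ t.
    by apply: eqS; rewrite ?size_cat; try lia; [apply: hxb|apply: hax].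
  case: (cat_eq_cat e) => [[c [ez et]]|[c hc [ea _]]].
    have := congr1 size ez; rewrite size_cat => sc.
    case: (@no_overlap a c b); rewrite -?ez -?et; [by left|by right|lia|lia|lia].
  by have := congr1 size ea; rewrite size_cat; lia.
case: (hx) (hy) => h1 [] h2.
- have e : x ++ b = y ++ b.
    by apply: eqS; rewrite ?size_cat; try lia; apply: hxb.
  by have [] := cat_inj_size (or_introl sxy) e.
- apply: mixed => //.
  by case: kind => // [[_ /(lr_disjoint H) /(_ h2)]|[/(lr_disjoint H h1)]].
- apply/esym; apply: mixed => //.
  by case: kind => // [[/(lr_disjoint H) /(_ h1)]|[_ /(lr_disjoint H h2)]].
have e : a ++ x = a ++ y.
  by apply: eqS; rewrite ?size_cat; try lia; apply: hax.
by have [] := cat_inj_size (or_introl erefl) e.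
Qed.

(** A word [v] one letter shorter than [x ++ y], lengthened by one letter, must equal [x ++ y] by
    uniqueness; then [v] overlaps [y] or [x]. *)
Lemma no_long_pair x y : lw x -> rw y -> 1 < size x -> 1 < size y ->
  size x + size y <= h -> False.
Proof.
move=> hx hy sx sy sxy.
have [a ha sa] := lw_letter H; have [b hb sb] := rw_letter H.
have [|v hv sv] := @lr_exists (size x + size y - 1); first lia.
have hxy : S (x ++ y) by apply: (lr_merge H) => //; lia.
case: (hv) => hv'.
  have e : x ++ y = v ++ b.
    apply: lr_unique; rewrite ?size_cat //; try lia; last by constructor; lia.
    by apply: (lr_merge H) => //; lia.
  case: (cat_eq_cat e) => [[c [ex _]]|[c hc [ev ey]]].
    by have := congr1 size ex; rewrite size_cat; lia.
  by case: (@no_overlap x c b); rewrite -?ev -?ey //; [right|lia|lia].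
have e : a ++ v = x ++ y.
  apply: lr_unique; rewrite ?size_cat //; try lia; last by constructor; lia.
  by apply: (lr_merge H) => //; lia.
case: (cat_eq_cat e) => [[c [ea _]]|[c hc [ex ev]]].
  by have := congr1 size ea; rewrite size_cat; lia.
by case: (@no_overlap a c y); rewrite -?ev -?ex //; [left|lia|lia].
Qed.

End Unique.
End System.

(** * The code of a system, its reversal and its short prefixes *)

Definition lr_code n k lw rw : set (seq T) :=
  [set c | size c = n /\ exists A x y B, [/\ star lw A, lw x, rw y, star rw B &
    k < size x + size y /\ c = A ++ (x ++ y) ++ B]].

Lemma lr_code_rev n k lw rw c :
  lr_code n k lw rw c -> lr_code n k (rw \o rev) (lw \o rev) (rev c).
Proof.
move=> [sc [A [x [y [B [hA hx hy hB [hk e]]]]]]]; split; first by rewrite size_rev.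
exists (rev B), (rev y), (rev x), (rev A); rewrite /= !revK !size_rev.
split=> //; [exact: star_rev|exact: star_rev|split; first lia].
by rewrite e !rev_cat !catA.
Qed.

Lemma lr_code_revP n k lw rw c :
  lr_code n k (rw \o rev) (lw \o rev) c <-> lr_code n k lw rw (rev c).
Proof.
split=> [/lr_code_rev|/lr_code_rev]; last by rewrite revK.
by rewrite !comp_revK.
Qed.

Lemma prefix_in_rev n k lw rw s :
  prefix_in (lr_code n k (rw \o rev) (lw \o rev)) s <->
  suffix_in (lr_code n k lw rw) (rev s).
Proof.
split=> [[c /lr_code_revP hc]|[c hc]] hp.
  by exists (rev c); rewrite ?suffix_rev.
by exists (rev c); [apply/lr_code_revP; rewrite revK|rewrite -suffix_rev revK].
Qed.

Lemma suffix_in_rev n k lw rw s :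
  suffix_in (lr_code n k (rw \o rev) (lw \o rev)) s <->
  prefix_in (lr_code n k lw rw) (rev s).
Proof.
split=> [[c /lr_code_revP hc]|[c hc]] hp.
  by exists (rev c); rewrite ?prefix_rev.
by exists (rev c); [apply/lr_code_revP; rewrite revK|rewrite -prefix_rev revK].
Qed.

(** The form in which maximality is used. It speaks of [prefix] and [suffix], which reversal
    exchanges, instead of [take] and [drop]. *)
Definition unextendable n k (C : set (seq T)) : Prop :=
  forall w, size w = n -> ~ C w ->
    (forall s, 0 < size s <= k -> suffix s w -> ~ prefix_in C s) ->
    (forall s, 0 < size s <= k -> prefix s w -> ~ suffix_in C s) ->
    (forall s, 0 < size s <= k -> prefix s w -> suffix s w -> False) -> False.

Lemma unextendable_rev n k lw rw : unextendable n k (lr_code n k lw rw) ->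
  unextendable n k (lr_code n k (rw \o rev) (lw \o rev)).
Proof.
move=> hM w sw hw h1 h2 h3; apply: (hM (rev w)); first by rewrite size_rev.
- by move=> h; apply: hw; apply/lr_code_revP.
- move=> s ss hs hp; apply: (h2 (rev s)); rewrite ?size_rev //.
    by rewrite prefix_revLR.
  by apply/suffix_in_rev; rewrite revK.
- move=> s ss hs hp; apply: (h1 (rev s)); rewrite ?size_rev //.
    by rewrite suffix_revLR.
  by apply/prefix_in_rev; rewrite revK.
move=> s ss hp hs; apply: (h3 (rev s)); rewrite ?size_rev //.
  by rewrite prefix_revLR.
by rewrite suffix_revLR.
Qed.

Lemma prefix_in_trans (C : set (seq T)) x y :
  prefix x y -> prefix_in C y -> prefix_in C x.
Proof. by move=> hxy [c hc hy]; exists c => //; apply: prefix_trans hy. Qed.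

(** A prefix that reaches past [A ++ x] ends strictly inside [y], since
    [size s <= k < size x + size y]; it then takes a proper prefix of [y]. *)
Lemma lr_code_prefix n k lw rw s : lr_system k lw rw ->
  size s <= k -> prefix_in (lr_code n k lw rw) s -> star lw s.
Proof.
move=> H ss [c [_ [A [x [y [B [hA hx hy hB [hk ->]]]]]]] /prefixP [r]].
rewrite -!catA catA => /esym e; have hAx := star_cat hA (star1 hx).
case: (cat_eq_cat e) => [[d [es e']]|[d hd [e' _]]]; last first.
  by rewrite e' in hAx; apply: (star_lw_prefix H hAx).
rewrite es; apply: star_cat => //.
case: (cat_eq_cat (esym e')) => [[d' [ed _]]|[d' hd' [ey _]]].
  by move: ss; rewrite es ed !size_cat; lia.
by apply: (@proper_prefix k lw rw H d d') => //; right; rewrite -ey.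
Qed.

Lemma lr_code_suffix n k lw rw s : lr_system k lw rw ->
  size s <= k -> suffix_in (lr_code n k lw rw) s -> star rw s.
Proof.
move=> H ss hs; have := @lr_code_prefix n _ _ _ (rev s) (lr_system_rev H).
rewrite size_rev => /(_ ss); rewrite prefix_in_rev revK => /(_ hs) /star_rev.
by rewrite comp_revK revK.
Qed.

(** * Words that could be added to the code *)

Section Maximal.
Variables (n k : nat) (lw rw : set (seq T)).
Hypothesis H : lr_system k lw rw.
Let C := lr_code n k lw rw.
Hypothesis hM : unextendable n k C.
Hypothesis hkn : k < n.

Lemma disjoint_pos c : 0 < size c -> star lw c -> star rw c -> False.
Proof. by move=> sc hl hr; rewrite (star_disjoint H hl hr) in sc. Qed.

(* A word of [star lw] is outside [C], and its prefixes are never suffixes of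
   codewords; only overlaps by its suffixes in [star lw] can block adding it. *)
Lemma no_extension w q : star lw w -> lw q -> size (w ++ q) = n ->
  (forall p s, p ++ s = w ++ q -> 0 < size s <= k -> star lw s ->
     ~ prefix_in C s /\ ~~ prefix s (w ++ q)) -> False.
Proof.
move=> hw hq sn hs; have sq := lw_size H hq.
have hwq : star lw (w ++ q) by apply: star_cat => //; apply: star1.
have hpre s : prefix s (w ++ q) -> star lw s.
  by move=> /prefixP [r e]; rewrite e in hwq; apply: (star_lw_prefix H hwq).
apply: (hM sn).
- move=> hC; apply: (@disjoint_pos q); [lia|exact: star1|].
  apply: (@lr_code_suffix n k lw rw) => //; first lia.
  by exists (w ++ q) => //; apply: suffix_suffix.
- move=> s ss /suffixP [p e] hp; case: (hs p s) => //.
  by apply: (@lr_code_prefix n k lw rw) => //; lia.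
- move=> s ss /hpre hl hr; apply: (@disjoint_pos s) => //; first lia.
  by apply: (@lr_code_suffix n k lw rw) => //; lia.
move=> s ss hp /suffixP [p e]; case: (hs p s) => //; first exact: hpre.
by rewrite hp.
Qed.

(** The word to add is [p ++ q]. A suffix of length at most [k] other than [q] starts strictly
    inside [p] or [q]; it has a non-empty prefix in [star rw], so it is not in [star lw]. *)
Lemma no_extension2 p q : lw p -> lw q -> size p + size q = n ->
  ~ prefix_in C q -> ~~ prefix q p -> False.
Proof.
move=> hp hq sn hqC hqp; have sp := lw_size H hp; have sq := lw_size H hq.
apply: (@no_extension p q (star1 hp)) => //; first by rewrite size_cat.
move=> p' s e ss hs.
have -> : s = q.
  case: (cat_eq_cat e) => [[[|c0 c] [_ eq]] //|[c hc [ep es]]].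
    case: (@disjoint_pos s) => //; first lia.
    by apply: (@proper_suffix k lw rw H (c0 :: c)) => //; left; rewrite -eq.
  case: (@disjoint_pos c) => //.
    by rewrite es in hs; apply: (star_lw_prefix H hs).
  apply: (@proper_suffix k lw rw H p'); first by left; rewrite -ep.
  by have := congr1 size ep; move: ss; rewrite es !size_cat; lia.
split=> //; apply/prefixP => [[r /cat_eq_cat]].
case=> [[c [ep _]]|[c hc [eq1 eq2]]].
  by rewrite ep prefix_prefix in hqp.
apply: (@disjoint_pos c) => //.
  by have := star1 hq; rewrite eq2; apply: (star_lw_prefix H).
by apply: (@proper_suffix k lw rw H p); [left; rewrite -eq1|lia].
Qed.

(** The word to add is [z ++ v ++ u]; as above, its only suffixes to consider are [u] and [v ++ u].
    If [u] were a prefix, it would be [z ++ v], with [v] as a proper suffix. *)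
Lemma no_extension3 z v u : lw z -> lw v -> lw u ->
  size z + size v = size u -> size u + size u = n ->
  ~ prefix_in C u -> ~ prefix_in C (v ++ u) -> False.
Proof.
move=> hz hv hu szv su huC hvuC.
have sz := lw_size H hz; have sv := lw_size H hv; have su' := lw_size H hu.
have hvu := star_cat (star1 hv) (star1 hu).
apply: (@no_extension (z ++ v) u) => //.
- exact: star_cat (star1 hz) (star1 hv).
- by rewrite !size_cat; lia.
move=> p s e ss hs.
have [->|->] : s = u \/ s = v ++ u.
  case: (cat_eq_cat e) => [[[|c0 c] [_ eu]]|[c hc [ep es]]]; first by left.
    case: (@disjoint_pos s) => //; first lia.
    by apply: (@proper_suffix k lw rw H (c0 :: c)) => //; left; rewrite -eu.
  have hlc : star lw c by rewrite es in hs; apply: (star_lw_prefix H hs).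
  case: (cat_eq_cat (esym ep)) => [[[|d0 d] [_ ev]]|[d hd [ez ec]]].
  - by right; rewrite es ev.
  - case: (@disjoint_pos c) => //.
    by apply: (@proper_suffix k lw rw H (d0 :: d)) => //; left; rewrite -ev.
  case: (@disjoint_pos d) => //.
    by rewrite ec in hlc; apply: (star_lw_prefix H hlc).
  apply: (@proper_suffix k lw rw H p); first by left; rewrite -ez.
  by have := congr1 size ez; move: ss; rewrite es ec !size_cat; lia.
- split=> //; apply/prefixP => [[r e']].
  have [e'' _] : z ++ v = u /\ u = r.
    by apply: cat_inj_size e'; left; rewrite size_cat.
  apply: (@disjoint_pos v); [lia|exact: star1|].
  by apply: (@proper_suffix k lw rw H z); [left; rewrite e''|lia].
(* If [v ++ u] were a prefix, then, wherever the cuts fall, a non-empty proper suffix of [z], [v] or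
   [u] would lie in [star lw]. *)
split=> //; apply/prefixP => [[r]]; rewrite -catA => /cat_eq_cat.
case=> [[c [ez _]]|[c hc [e1 e2]]].
  by have := congr1 size ez; rewrite !size_cat; lia.
have hlc : star lw c by rewrite e2 in hvu; apply: (star_lw_prefix H hvu).
case: (cat_eq_cat e1) => [[d [ev ec]]|[d hd [ez eu]]].
  case: d ev ec => [|d0 d] ev ec.
    rewrite /= in ec; rewrite {}ec in e2 *.
    case: (cat_eq_cat e2) => [[e' [ev' _]]|[e' he' [eu1 eu2]]].
      by have := congr1 size ev'; rewrite size_cat; lia.
    apply: (@disjoint_pos e') => //.
      by have := star1 hu; rewrite eu2; apply: (star_lw_prefix H).
    by apply: (@proper_suffix k lw rw H v); [left; rewrite -eu1|lia].
  apply: (@disjoint_pos (d0 :: d)) => //.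
    by rewrite ec in hlc; apply: (star_lw_prefix H hlc).
  by apply: (@proper_suffix k lw rw H z); [left; rewrite -ev|lia].
apply: (@disjoint_pos d) => //.
  by have := star1 hu; rewrite eu; apply: (star_lw_prefix H).
by apply: (@proper_suffix k lw rw H v); [left; rewrite -ez|lia].
Qed.

Lemma star_exists P m : (exists2 a, P a & size a = 1) ->
  exists2 A, star P A & size A = m.
Proof.
move=> [a ha sa]; elim: m => [|m [A hA sA]]; first by exists [::]; [apply: star_nil|].
by exists (a ++ A); [apply: star_cons|rewrite size_cat; lia].
Qed.

(** Padding on the right with copies of a letter of [rw] gives a codeword. *)
Lemma lr_code_pair x y : lw x -> rw y -> k < size x + size y <= n ->
  prefix_in C (x ++ y).
Proof.
move=> hx hy sxy.
have [B hB sB] := star_exists (n - (size x + size y)) (rw_letter H).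
exists ((x ++ y) ++ B); last exact: prefix_prefix.
split; first by rewrite !size_cat; lia.
by exists [::], x, y, B; split=> //; [apply: star_nil|split=> //; lia].
Qed.

Lemma nonprefix_rw x y : lw x -> ~ prefix_in C x -> rw y ->
  k < size x + size y <= n -> False.
Proof.
move=> hx hxC hy sxy; apply: hxC; apply: prefix_in_trans (lr_code_pair hx hy sxy).
exact: prefix_prefix.
Qed.

(** Otherwise at least [k.+1] positions follow [x], enough for a pair [l], [r] of total length
    [k.+1], made from a word of length [k] and a letter; the gap is filled with letters of [lw]. *)
Lemma nonprefix_long x : lw x -> ~ prefix_in C x -> n - size x <= k.
Proof.
move=> hx hxC; rewrite leqNgt; apply/negP => hlt; apply: hxC.
have sx := lw_size H hx.
have [l [r [hl hr slr]]] : exists l r, [/\ lw l, rw r & size l + size r = k.+1].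
  have [a ha sa] := lw_letter H; have [b hb sb] := rw_letter H.
  have [|v [hv|hv] sv] := lr_exists H (i := k); first lia.
    by exists v, b; split=> //; lia.
  by exists a, v; split=> //; lia.
have [A hA sA] := star_exists (n - size x - k.+1) (lw_letter H).
exists ((x ++ A) ++ (l ++ r) ++ [::]); last by rewrite -catA prefix_prefix.
split; first by rewrite !size_cat /=; lia.
exists (x ++ A), l, r, [::]; split=> //; last by split=> //; lia.
  exact: star_cons.
exact: star_nil.
Qed.

Lemma lw_prefix x : lw x -> size x + size x <> n -> prefix_in C x.
Proof.
move=> hx sxn; apply: contrapT => hxC.
have sx := lw_size H hx; have ln := nonprefix_long hx hxC.
have [|z [hz|hz] sz] := lr_exists H (i := n - size x); first lia; last first.
  by apply: (nonprefix_rw hx hxC hz); lia.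
have [hxz|hxz] := boolP (prefix x z); last first.
  by apply: (no_extension2 hz hx) => //; lia.
apply: (no_extension2 hx hz); first lia.
  by move=> /(prefix_in_trans hxz).
(* Here [x] and [z] are prefixes of each other, so they have the same length, which is then half of
   [n]. *)
apply/negP => /prefixP [d ed]; move/prefixP: hxz => [c ec].
have ez : size z = size x + size c by rewrite ec size_cat.
have ex : size x = size z + size d by rewrite {1}ed size_cat.
lia.
Qed.

(* When there is no word of length [size u - 1] in [lw], the only remaining
   case is [k = n - 1], where [u z] with [z] in [rw] of that length completes
   [u] or [v u] to a codeword. *)
Lemma lw_cat_prefix u v : (forall x, (lw `|` rw) x -> size x = size u -> x = u) ->
  size u + size u = n -> lw u -> ~ prefix_in C u -> lw v ->
  size v + size u <= k -> prefix_in C (v ++ u).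
Proof.
move=> uq sun hu huC hv svu; apply: contrapT => hvuC.
have su := lw_size H hu; have sv := lw_size H hv.
have [|z [hz|hz] sz] := lr_exists H (i := size u - size v); first lia.
  by apply: (no_extension3 hz hv hu) => //; lia.
have [sv1|sv1] := leqP (size v) 1; last first.
  (* If [z] in [rw] has several letters, [v] and [z] form a pair excluded by [no_long_pair]; if it
     is a letter, a letter of [lw] takes its place. *)
  have [sz1|sz1] := leqP (size z) 1; last first.
    by apply: (no_long_pair H _ uq hv hz); lia.
  have [a ha sa] := lw_letter H.
  by apply: (no_extension3 ha hv hu) => //; lia.
have [hk|hk] := ltnP k (size u + size z).
  by apply: (nonprefix_rw hu huC hz); lia.
have [b hb sb] := rw_letter H.
case: (lr_merge H hu hz) => // huz.
  apply: huC; apply: (@prefix_in_trans _ u ((u ++ z) ++ b)).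
    by rewrite -catA prefix_prefix.
  by apply: lr_code_pair => //; rewrite !size_cat; lia.
apply: hvuC; apply: (@prefix_in_trans _ (v ++ u) (v ++ (u ++ z))).
  by rewrite catA prefix_prefix.
by apply: lr_code_pair => //; rewrite !size_cat; lia.
Qed.

End Maximal.

(** * From admissible families to systems *)

Section Families.
Variables (n k : nat) (L R : nat -> set (seq T)).
Hypothesis hadm : admissible k L R.

Definition graded (F : nat -> set (seq T)) : set (seq T) :=
  [set x | 0 < size x <= k /\ F (size x) x].

Lemma admissible_factor i w : 1 < i <= k -> (L i `|` R i) w <->
  exists j x y, [/\ 0 < j < i, L j x, R (i - j) y & w = x ++ y].
Proof.
move=> hi; have [_ _ _ /(_ i hi) [-> _]] := hadm.
split=> [[j hj [x hx [y hy <-]]]|[j [x [y [hj hx hy ->]]]]].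
  by exists j, x, y; split=> //; move: hj => /=; lia.
by exists j => /=; [lia|exists x => //; exists y].
Qed.

Lemma admissible_size i x : 0 < i <= k -> (L i `|` R i) x -> size x = i.
Proof.
have [m] := ubnP i; elim: m i x => // m IH i x hm hi hx.
have [i1|i1] := leqP i 1.
  have e : i = 1 by lia.
  by move: hx; rewrite e; have [[-> _] _ _ _] := hadm.
have hi' : 1 < i <= k by lia.
have [j [y [z [hj hy hz ->]]]] := (admissible_factor x hi').1 hx.
rewrite size_cat (IH j y) ?(IH (i - j) z); try lia; first by right.
by left.
Qed.

Lemma graded_L i x : 0 < i <= k -> L i x -> graded L x /\ size x = i.
Proof.
move=> hi hx; have e := admissible_size hi (or_introl hx).
by rewrite /graded /= e.
Qed.

Lemma graded_R i x : 0 < i <= k -> R i x -> graded R x /\ size x = i.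
Proof.
move=> hi hx; have e := admissible_size hi (or_intror hx).
by rewrite /graded /= e.
Qed.

Lemma admissible_lr_system : 0 < k -> lr_system k (graded L) (graded R).
Proof.
move=> k0; have [b1 [a ha] [b hb] hb2] := hadm; split.
- by move=> x [].
- by move=> x [].
- move=> x [sx hl] [_ hr]; suff : (L (size x) `&` R (size x)) x.
    have [s1|s1] := leqP (size x) 1; last first.
      by have [_ ->] := hb2 (size x) ltac:(lia).
    have -> : size x = 1 by lia.
    by have [_ ->] := b1.
  by [].
- by exists a; have [] := @graded_L 1 a ltac:(lia) ha.
- by exists b; have [] := @graded_R 1 b ltac:(lia) hb.
- move=> w hw sw.
  have [sk hw'] : size w <= k /\ (L (size w) `|` R (size w)) w.
    by case: hw => -[/andP [_ ->] ?]; split=> //; [left|right].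
  have si : 1 < size w <= k by lia.
  have [j [x [y [hj hx hy ->]]]] := (admissible_factor w si).1 hw'.
  exists x, y; split=> //.
    by have [] := @graded_L j x ltac:(lia) hx.
  by have [] := @graded_R (size w - j) y ltac:(lia) hy.
move=> x y [sx hx] [sy hy] sxy.
have si : 1 < size (x ++ y) <= k by rewrite size_cat; lia.
suff : (L (size (x ++ y)) `|` R (size (x ++ y))) (x ++ y).
  by case=> hw; [left|right]; split=> //; lia.
apply/(admissible_factor _ si); exists (size x), x, y; split=> //.
  by rewrite size_cat; lia.
by rewrite size_cat addKn.
Qed.

Lemma star_lcats (F : nat -> set (seq T)) a w :
  (forall i x, 0 < i <= k -> F i x -> graded F x) ->
  all (fun i => 0 < i <= k) a -> lcats (map F a) w -> star (graded F) w.
Proof.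
move=> hF; elim: a w => [|i a IH] w /=; first by move=> _ ->; apply: star_nil.
move=> /andP [hi ha] [x hx [y hy <-]]; apply: star_cons; last exact: IH.
exact: hF hx.
Qed.

(** The composition lists the lengths of the factors. *)
Lemma lcats_star (F : nat -> set (seq T)) w : star (graded F) w ->
  exists a, [/\ all (leq 1) a, sumn a = size w & lcats (map F a) w].
Proof.
elim=> [|x w' [sx hx] _ [a [h1 h2 h3]]]; first by exists [::].
exists (size x :: a); rewrite /= h1 h2 size_cat; split=> //; first by rewrite andbT; lia.
by exists x => //; exists w'.
Qed.

Lemma associated_code_lr : k < n <= k + k.+1 -> associated_code n k L R `<=` words n ->
  associated_code n k L R = lr_code n k (graded L) (graded R).
Proof.
move=> hnk hn; apply/seteqP; split=> c hc.
  split; first exact: hn.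
  move: hc => [s /= hs [j /= hj [a [/= ha sa] [i /= hi]]]].
  move=> [A hA [_ [_ [x hx [y hy <-]] [B hB <-]] <-]].
  have [hx' sx] := @graded_L j x ltac:(lia) hx.
  have [hy' sy] := @graded_R (s - j) y ltac:(lia) hy.
  (* Parts are at most [n - s <= n - k.+1 <= k], so only indices constrained by admissibility
     occur. *)
  have hak : all (fun m => 0 < m <= k) a.
    apply/allP => m hm; have := allP ha m hm.
    have : m <= sumn a.
      move: hm; clear; elim: a => //= b a IH; rewrite in_cons => /orP [/eqP ->|/IH]; lia.
    by rewrite sa; lia.
  have : all (fun m => 0 < m <= k) (take i a ++ drop i a) by rewrite cat_take_drop.
  rewrite all_cat => /andP [ha1 ha2].
  exists A, x, y, B; split=> //.
  - by apply: star_lcats ha1 hA => m z hm hz; have [] := graded_L hm hz.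
  - by apply: star_lcats ha2 hB => m z hm hz; have [] := graded_R hm hz.
  by split=> //; lia.
move: hc => [sc [A [x [y [B [hA [sx hx] [sy hy] hB [hk ec]]]]]]].
have [a [ha sa hAa]] := lcats_star hA; have [b [hb sb hBb]] := lcats_star hB.
have sizes : size c = size A + (size x + size y) + size B.
  by rewrite ec !size_cat; lia.
exists (size x + size y) => /=; first by lia.
exists (size x) => /=; first by lia.
exists (a ++ b); first by split; [rewrite /= all_cat ha hb|rewrite sumn_cat sa sb; lia].
exists (size a) => /=; first by rewrite size_cat; lia.
rewrite take_size_cat // drop_size_cat // addKn ec.
by exists A => //; exists ((x ++ y) ++ B) => //; exists (x ++ y);
  [exists x => //; exists y|exists B].
Qed.

(** An overlap in the enlarged code is between two codewords, between [w] and a codeword, or of [w]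
    with itself. *)
Lemma maximal_unextendable C : k < n -> maximal_overlap_free n k C -> unextendable n k C.
Proof.
move=> hkn [hCn hfree hmax] w sw hw h1 h2 h3; apply: (hmax w sw hw).
have pre t x : size x = n -> 0 < t <= k -> 0 < size (take t x) <= k.
  by move=> sx ht; rewrite size_take sx; case: ifP; lia.
have suf t x : size x = n -> 0 < t <= k -> 0 < size (drop (size x - t) x) <= k.
  by move=> sx ht; rewrite size_drop sx; lia.
have mix t x : 0 < t <= k -> C x ->
    take t x <> drop (size w - t) w /\ take t w <> drop (size x - t) x.
  move=> ht hx; split=> e.
    apply: (h1 (drop (size w - t) w)); [exact: suf|exact: suffix_drop|].
    by exists x => //; rewrite -e prefix_take.
  apply: (h2 (take t w)); [exact: pre|exact: prefix_take|].
  by exists x => //; rewrite e suffix_drop.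
have self t : 0 < t <= k -> take t w <> drop (size w - t) w.
  move=> ht e; apply: (h3 (take t w)); [exact: pre|exact: prefix_take|].
  by rewrite e suffix_drop.
move=> t ht x y [hx|->] [hy|->] [].
- by move=> e; apply: (hfree t ht x y hx hy); left.
- by move=> e; apply: (hfree t ht x y hx hy); right.
- by case: (mix t x ht hx).
- by case: (mix t x ht hx).
- by case: (mix t y ht hy).
- by case: (mix t y ht hy).
- exact: self.
- exact: self.
Qed.

End Families.

Lemma lcat_set1 (A B : set (seq T)) x y :
  A = [set x] -> B = [set y] -> lcat A B = [set x ++ y].
Proof.
move=> -> ->; apply/seteqP; split=> w; first by move=> [_ -> [_ -> <-]].
by move=> ->; exists x => //; exists y.
Qed.

End LRSystems.

(** * The three claims for families *)

Theorem proposition8 (Sigma : finType) (n k : nat)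
    (L R : nat -> set (seq Sigma)) (C : set (seq Sigma)) (u : seq Sigma)
    (hSigma : 2 <= #|Sigma|) (hn2 : 2 <= n) (hn : ~~ odd n)
    (hk : n./2 <= k <= n - 1)
    (hadm : admissible k L R)
    (hC : C = associated_code n k L R)
    (hmax : maximal_overlap_free n k C)
    (hu : L n./2 `|` R n./2 = [set u]) :
  [/\ (* (i) *)
      forall t, 1 <= t <= k -> t <> n./2 ->
        (forall x, L t x -> prefix_in C x) /\
        (forall x, R t x -> suffix_in C x),
      (* (ii) *)
      L n./2 u -> ~ prefix_in C u ->
        (forall j, 2 <= j <= k - n./2 -> L j !=set0 ->
           exists2 w, lcat (L j) (L n./2) = [set w] & prefix_in C w) /\
        (n./2 < k ->
           (exists2 w, lcat (L 1) (L n./2) = [set w] & prefix_in C w) \/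
           (L (n./2 - 1) = set0 /\
            forall j, 1 <= j <= k - n./2 - 1 -> L j !=set0 ->
              exists2 w, lcat (lcat (L j) (L 1)) (L n./2) = [set w]
                & prefix_in C w))
    & (* (iii) *)
      R n./2 u -> ~ suffix_in C u ->
        (forall j, 2 <= j <= k - n./2 -> R j !=set0 ->
           exists2 w, lcat (R n./2) (R j) = [set w] & suffix_in C w) /\
        (n./2 < k ->
           (exists2 w, lcat (R n./2) (R 1) = [set w] & suffix_in C w) \/
           (R (n./2 - 1) = set0 /\
            forall j, 1 <= j <= k - n./2 - 1 -> R j !=set0 ->
              exists2 w, lcat (lcat (R n./2) (R 1)) (R j) = [set w]
                & suffix_in C w))].
Proof.
have en : n = n./2 + n./2 by have := odd_double_half n; rewrite (negbTE hn); lia.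
move: (n./2) hk hu en => h hk hu en; have h0 : 0 < h by lia.
have k0 : 0 < k by lia.
have hnk : k < n <= k + k.+1 by lia.
have hkn : k < n by lia.
have H : lr_system k (graded k L) (graded k R).
  exact: (admissible_lr_system hadm k0).
have HR := lr_system_rev H.
have eC : C = lr_code n k (graded k L) (graded k R).
  by rewrite hC; apply: (associated_code_lr hadm hnk); rewrite -hC; case: hmax.
have hM : unextendable n k (lr_code n k (graded k L) (graded k R)).
  by rewrite -eC; apply: maximal_unextendable.
have hMR := unextendable_rev hM.
have hhk : 0 < h <= k by lia.
have su : size u = h by apply: (admissible_size hadm hhk); rewrite hu.
have uq x : (graded k L `|` graded k R) x -> size x = h -> x = u.
  move=> hx sx; have : (L h `|` R h) x.
    by case: hx => -[_]; rewrite sx; [left|right].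
  by rewrite hu.
have uqL i x : 0 < i <= h -> L i x -> L i = [set x].
  move=> hi hx; apply/seteqP; split=> [y hy|_ ->] //=.
  have hi' : 0 < i <= k by lia.
  have [[gx sx] [gy sy]] := (graded_L hadm hi' hx, graded_L hadm hi' hy).
  by apply: (lr_unique H _ uq); [lia|left|left|lia|lia|constructor 2].
have uqR i x : 0 < i <= h -> R i x -> R i = [set x].
  move=> hi hx; apply/seteqP; split=> [y hy|_ ->] //=.
  have hi' : 0 < i <= k by lia.
  have [[gx sx] [gy sy]] := (graded_R hadm hi' hx, graded_R hadm hi' hy).
  by apply: (lr_unique H _ uq); [lia|right|right|lia|lia|constructor 3].
(* Including [j = 1] serves both claims of (ii). The factors are singletons because
   [j <= k - h < h]. *)
have preL : L h u -> ~ prefix_in C u -> forall j, 0 < j <= k - h ->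
    L j !=set0 -> exists2 w, lcat (L j) (L h) = [set w] & prefix_in C w.
  move=> hLu huC j hj [v hv].
  have hj' : 0 < j <= k by lia.
  have [gv sv] := graded_L hadm hj' hv; have [gu _] := graded_L hadm hhk hLu.
  exists (v ++ u).
    by apply: lcat_set1; apply: uqL => //; lia.
  rewrite eC in huC *; apply: (lw_cat_prefix H hM hkn) => //; try lia.
  by rewrite su.
have sufR : R h u -> ~ suffix_in C u -> forall j, 0 < j <= k - h ->
    R j !=set0 -> exists2 w, lcat (R h) (R j) = [set w] & suffix_in C w.
  move=> hRu huC j hj [v hv].
  have hj' : 0 < j <= k by lia.
  have [gv sv] := graded_R hadm hj' hv; have [gu _] := graded_R hadm hhk hRu.
  exists (u ++ v).
    by apply: lcat_set1; apply: uqR => //; lia.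
  (* The mirror image of [u ++ v] is [rev v ++ rev u], to which the prefix result applies in the
     reversed system. *)
  rewrite eC in huC *; rewrite -[u ++ v]revK; apply/prefix_in_rev; rewrite rev_cat.
  apply: (lw_cat_prefix HR hMR hkn); rewrite ?size_rev //=; rewrite ?revK //; try lia.
    move=> x hx sx; rewrite -(uq (rev x)) ?revK ?size_rev //; last lia.
    by case: hx; [right|left].
  by move/prefix_in_rev; rewrite revK.
have [_ hL1 hR1 _] := hadm.
split.
- move=> t ht hth; have ht' : 0 < t <= k by [].
  split=> x hx; rewrite eC.
    have [gx sx] := graded_L hadm ht' hx.
    by apply: (lw_prefix H hM hkn) => //; lia.
  have [gx sx] := graded_R hadm ht' hx; rewrite -[x]revK; apply/prefix_in_rev.
  by apply: (lw_prefix HR hMR hkn); rewrite ?size_rev /= ?revK //; lia.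
- move=> hLu huC; split=> [j hj|hhk']; first by apply: preL => //; lia.
  by left; apply: preL => //; lia.
move=> hRu huC; split=> [j hj|hhk']; first by apply: sufR => //; lia.
by left; apply: sufR => //; lia.
Qed.
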